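(* Let $G$ be a conjugation-free group such that $\beta(Gr(G))\le 1$. For $i\ge3$ let $n_i$ be the number of cyclic relations of length $i$ of $G$. Then $$\phi_3(G)=\sum_{i\ge3} n_i\,\omega_3(i-1).$$
   Context: Lower central series: for a group $G$ put $[a,b]=a^{-1}b^{-1}ab$, $G_1=G$, $G_k=[G_{k-1},G]$ for $k\ge2$, and for finitely generated $G$ let $\phi_k(G)=\operatorname{rank}(G_k/G_{k+1})$ be the rank of the finitely generated abelian group $G_k/G_{k+1}$. Let $\omega_k(n)=\phi_k(\mathbb{F}_n)$, where $\mathbb{F}_n$ is the free group of rank $n$. Conjugation-free group: a finitely presented group $G$ is conjugation-free if it has a presentation with generators $x_1,\dots,x_n$ and relations $R_1,\dots,R_w$ such that: (1) each $R_p$ is a (conjugation-free) cyclic relation of some length $t\ge2$, i.e. of the form $$R_{p,(i_t,\dots,i_1)}:\quad x_{i_t}x_{i_{t-1}}\cdots x_{i_1}=x_{i_{t-1}}\cdots x_{i_1}x_{i_t}=\cdots=x_{i_1}x_{i_t}\cdots x_{i_2},$$ where $i_1<i_2<\dots<i_t$ are indices in $\{1,\dots,n\}$ (for $t=2$ this is the commutator relation $[x_{i_1},x_{i_2}]=e$); (2) for every pair $j_1\ne j_2$ in $\{1,\dots,n\}$ there is a unique relation $R_{p,(i_t,\dots,i_1)}$ with $\{j_1,j_2\}\subseteq\{i_1,\dots,i_t\}$; (3) for any two relations $R_{p,(i_t,\dots,i_1)}$, $R_{p',(j_s,\dots,j_1)}$ with $p\ne p'$, $|\{i_1,\dots,i_t\}\cap\{j_1,\dots,j_s\}|\le1$.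 Such a presentation is fixed as part of the data; the numbers $n_i$ and the graph $Gr(G)$ are taken with respect to it. Associated graph $Gr(G)$: it has one vertex for each multiple relation, i.e. each cyclic relation of length $t\ge3$; two vertices, corresponding to $R_{p,(i_t,\dots,i_1)}$ and $R_{p',(j_s,\dots,j_1)}$, are joined by an edge if the sets $\{i_1,\dots,i_t\}$ and $\{j_1,\dots,j_s\}$ have exactly one common index. $\beta(Gr(G))$ denotes the first Betti number of the graph $Gr(G)$. *)

(* Defs.v *)
From HB Require Import structures.
From mathcomp Require Import all_boot all_order all_algebra.
From mathcomp Require Import boolp classical_sets.

Set Implicit Arguments.
Unset Strict Implicit.
Unset Printing Implicit Defensive.

Local Open Scope group_scope.

(* Groups are [groupType]s (possibly infinite); subsets are [set G]. *)

Section Subgroups.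
Local Open Scope classical_set_scope.
Variable G : groupType.
Implicit Types (A H K : set G) (x y g h : G) (z : int).

Inductive generated A : set G :=
| generated_in g of A g : generated A g
| generated_1 : generated A 1
| generatedM g h of generated A g & generated A h : generated A (g * h)
| generatedV g of generated A g : generated A g^-1.

Definition normal_closure A : set G :=
  generated [set g | exists r, A r /\ exists y, g = r ^ y].

(* [~ x, y] is x^-1 * y^-1 * x * y. *)
Definition commutator_subgroup H K : set G :=
  generated [set g | exists x y, [/\ H x, K y & g = [~ x, y]]].

(* Indexed from 1: lcs 1 = G. The value at 0 is a junk value. *)
Fixpoint lcs (k : nat) : set G :=
  if k is k'.+1 then
    if k' is 0 then setT else commutator_subgroup (lcs k') setT
  else setT.

Definition zexpg x z : G :=
  match z with Posz m => x ^+ m | Negz m => x ^- m.+1 end.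

(* For K normal in H with H/K abelian: the cosets of a_0, ..., a_(r-1) are
   Z-linearly independent elements of H/K, which is written multiplicatively. *)
Definition independent_mod H K (r : nat) (a : 'I_r -> G) : Prop :=
  (forall i, H (a i)) /\
  (forall c : 'I_r -> int,
     K (\prod_(i < r) zexpg (a i) (c i)) -> forall i, c i = 0%R).

Definition has_independent_mod H K (r : nat) : Prop :=
  exists a : 'I_r -> G, independent_mod H K a.

(* Rank of the abelian group H/K: the largest size of a Z-linearly
   independent family. The default 0 is used only if there is no maximum,
   which does not happen when H/K is finitely generated. *)
Definition quotient_rank H K : nat :=
  xget 0%N [set r | has_independent_mod H K r /\
                    forall s, has_independent_mod H K s -> (s <= r)%N].

End Subgroups.

Definition phi (k : nat) (G : groupType) : nat :=
  quotient_rank (@lcs G k) (@lcs G k.+1).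

Section FreeGroup.
Variable n : nat.

(* (i, false) stands for x_i and (i, true) for its inverse. *)
Local Notation letter := ('I_n * bool)%type.

Definition inv_letter (l : letter) : letter := (l.1, ~~ l.2).

Definition reduced (s : seq letter) : bool :=
  sorted (fun l m => m != inv_letter l) s.

Record free_group := FreeGroup { word :> seq letter; word_reduced : reduced word }.
HB.instance Definition _ := [isSub for word].
HB.instance Definition _ := [Choice of free_group by <:].

Definition push (l : letter) (s : seq letter) : seq letter :=
  if s is m :: s' then if m == inv_letter l then s' else l :: s else [:: l].

Lemma inv_letterK : involutive inv_letter.
Proof. by case=> i b; rewrite /inv_letter /= negbK. Qed.

Lemma push_reduced l s : reduced s -> reduced (push l s).
Proof.
case: s => [|m s] //= rs; case: eqP => [_|/eqP ml]; first exact: path_sorted rs.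
by rewrite /reduced /= ml.
Qed.

Definition act (s t : seq letter) : seq letter := foldr push t s.

Lemma act_reduced s t : reduced t -> reduced (act s t).
Proof. by move=> rt; elim: s => //= l s; apply: push_reduced. Qed.

Lemma pushK l s : reduced s -> push (inv_letter l) (push l s) = s.
Proof.
case: s => [|m s] /= rs; first by rewrite inv_letterK eqxx.
case: eqP => [em|_]; last by rewrite /= inv_letterK eqxx.
move: rs; rewrite {m}em; case: s => [|p s] //= /andP[].
by rewrite inv_letterK => /negPf ->.
Qed.

Lemma act_push l s t : reduced t -> act (push l s) t = push l (act s t).
Proof.
move=> rt; case: s => [|m s] //=; case: eqP => [->|//].
by have := pushK (inv_letter l) (act_reduced s rt); rewrite inv_letterK.
Qed.

Lemma act_act s t u : reduced u -> act (act s t) u = act s (act t u).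
Proof. by move=> ru; elim: s => //= l s IHs; rewrite act_push // IHs. Qed.

Lemma act_nil s : reduced s -> act s [::] = s.
Proof.
elim: s => [|l [|m s] IHs] //= rs; have /andP[ml ps] := rs.
by move: (IHs ps) => /= ->; rewrite /= (negPf ml).
Qed.

Definition inv_word (s : seq letter) : seq letter := rev (map inv_letter s).

Lemma inv_word_reduced s : reduced s -> reduced (inv_word s).
Proof.
rewrite /reduced /inv_word rev_sorted sorted_map; apply: sub_sorted => l m /=.
by rewrite (can_eq inv_letterK) eq_sym (can2_eq inv_letterK inv_letterK).
Qed.

Lemma act_inv_word s t : reduced t -> act (inv_word s) (act s t) = t.
Proof.
move=> rt; elim: s => [|l s IHs] //=.
rewrite /inv_word /= rev_cons /act foldr_rcons.
by rewrite pushK ?IHs // act_reduced.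
Qed.

Definition free_one : free_group := @FreeGroup [::] isT.
Definition free_mul (s t : free_group) : free_group :=
  FreeGroup (act_reduced s (word_reduced t)).
Definition free_inv (s : free_group) : free_group :=
  FreeGroup (inv_word_reduced (word_reduced s)).

Lemma free_mulA : associative free_mul.
Proof. by move=> s t u; apply: val_inj; rewrite /= act_act // word_reduced. Qed.

Lemma free_mul1 : left_id free_one free_mul.
Proof. by move=> s; apply: val_inj. Qed.

Lemma free_mulr1 : right_id free_one free_mul.
Proof. by move=> s; apply: val_inj; rewrite /= act_nil // word_reduced. Qed.

Lemma free_mulVg : left_inverse free_one free_inv free_mul.
Proof.
move=> s; apply: val_inj => /=.
by rewrite -{2}(act_nil (word_reduced s)) act_inv_word.
Qed.

Lemma free_mulgV : right_inverse free_one free_inv free_mul.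
Proof.
move=> s; rewrite -[LHS]free_mul1 -(free_mulVg (free_inv s)) -free_mulA.
by rewrite (free_mulA (free_inv s)) free_mulVg free_mul1.
Qed.

HB.instance Definition _ := isGroup.Build free_group
  free_mulA free_mul1 free_mulr1 free_mulVg free_mulgV.

Definition free_gen (i : 'I_n) : free_group := @FreeGroup [:: (i, false)] isT.

Definition free_lift (G : groupType) (x : 'I_n -> G) (s : free_group) : G :=
  \prod_(l <- word s) (if l.2 then (x l.1)^-1 else x l.1).

Section Lift.
Variables (G : groupType) (x : 'I_n -> G).

Lemma free_lift_gen i : free_lift x (free_gen i) = x i.
Proof. by rewrite /free_lift big_seq1. Qed.

Lemma free_lift1 : free_lift x 1 = 1.
Proof. by rewrite /free_lift big_nil. Qed.

Lemma free_liftM : {morph free_lift x : s t / s * t}.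
Proof.
move=> s t; rewrite /free_lift /=; elim: (word s) => [|l r IHr] /=.
  by rewrite big_nil mul1g.
rewrite [in RHS]big_cons -mulgA -IHr; case: (act r t) => [|m u] /=.
  by rewrite big_cons.
case: eqP => [->|_]; last by rewrite big_cons.
by rewrite big_cons; case: l => i [] /=; rewrite ?mulKg ?mulVKg.
Qed.

HB.instance Definition _ :=
  isUMagmaMorphism.Build (free_group : groupType) G (free_lift x)
    (free_lift1, free_liftM).
End Lift.

End FreeGroup.

Definition omega (k n : nat) : nat := phi k (free_group n).

(* G = < x_0, ..., x_(n-1) | rels > : the morphism from the free group sending
   the generators to the x_i is onto, with kernel the normal closure of rels. *)
Definition is_presentation (G : groupType) (n : nat) (x : 'I_n -> G)
    (rels : set (free_group n)) : Prop :=
  (forall g : G, exists s, free_lift x s = g) /\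
  (forall s, free_lift x s = 1 <-> normal_closure rels s).

(* The word x_(i_t) ... x_(i_1) for A = {i_1 < ... < i_t}; [enum A] is
   increasing. *)
Definition cyclic_word (n : nat) (A : {set 'I_n}) : seq 'I_n := rev (enum A).

(* The cyclic relation on A says that all rotations of the word agree. *)
Definition cyclic_relators (n : nat) (A : {set 'I_n}) (r : free_group n) : Prop :=
  exists2 k : nat, (k < #|A|)%N &
    r = (\prod_(i <- rot k (cyclic_word A)) free_gen i)^-1
        * \prod_(i <- cyclic_word A) free_gen i.

(* R p is the index set {i_1 < ... < i_t} of the p-th relation. *)
Record conjugation_free_presentation (G : groupType) (n w : nat)
    (x : 'I_n -> G) (R : 'I_w -> {set 'I_n}) : Prop := {
  cf_presentation : is_presentation x (fun r => exists p, cyclic_relators (R p) r);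
  cf_length : forall p, (2 <= #|R p|)%N;
  cf_pair : forall j1 j2 : 'I_n, j1 != j2 ->
    exists! p : 'I_w, [set j1; j2] \subset R p;
  cf_meet : forall p q : 'I_w, p != q -> (#|R p :&: R q| <= 1)%N }.

Definition num_relations (n w : nat) (R : 'I_w -> {set 'I_n}) (i : nat) : nat :=
  #|[set p : 'I_w | #|R p| == i]|.

(* A finite simple graph is a symmetric irreflexive relation on a finType. Each
   edge is oriented from its smaller to its larger endpoint in enumeration
   order; b_1 is the dimension of H_1 = ker(d_1) over the rationals. *)
Section Betti.
Variables (T : finType) (e : rel T).

Definition oriented_edges : {set T * T} :=
  [set u | e u.1 u.2 & (enum_rank u.1 < enum_rank u.2)%N].

(* Acts on row vectors: the row of an edge (u, v) is v - u. *)
Definition boundary_mx : 'M[rat]_(#|oriented_edges|, #|T|) :=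
  (\matrix_(i, j) ((enum_val j == (enum_val i).2)%:R
                   - (enum_val j == (enum_val i).1)%:R))%R.

Definition betti1 : nat := \rank (kermx boundary_mx).
End Betti.

Section Graph.
Variables (n w : nat) (R : 'I_w -> {set 'I_n}).

Definition multiple_relation : finType := {p : 'I_w | (3 <= #|R p|)%N}.

Definition Gr : rel multiple_relation :=
  fun p q => (p != q) && (#|R (val p) :&: R (val q)| == 1)%N.
End Graph.
Arguments Gr {n w} R.

(* Main.v *)
Require Import Defs.
From HB Require Import structures.
From mathcomp Require Import all_boot all_order all_algebra ring.
From mathcomp Require Import generic_quotient boolp classical_sets.
Import GRing.Theory.

Set Implicit Arguments.
Unset Strict Implicit.
Unset Printing Implicit Defensive.

(** Everything happens in the abelian group gr_3(G) = G_3/G_4. It is spanned by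
    the classes T(a,b,c) of [[a,b],c], and T is additive in each argument,
    alternating, and satisfies the Jacobi identity (from Hall-Witt).

    Each relation p, of length t, has a free quotient: killing the generators
    outside R_p and the product c_p = x_(i_t) ... x_(i_1) turns all relations
    into trivial identities and gives f_p : G -> F_(t-1). It is split by the map
    s_p : F_(t-1) -> G sending the free generators to x_(i_(t-1)), ..., x_(i_1).
    On gr_3 one has f_p s_p = id, and f_q s_p = 0 for q <> p, because R_p and R_q
    share at most one index and T(a,a,b) = T(1,a,b) = 0. So the direct sum of the
    gr_3(F_(t_p - 1)) embeds in gr_3(G); it remains to see that
    D = id - sum_p s_p f_p vanishes ([nonlocal_eq0]), after which ranks add up
    ([rational_basis_direct_sum]) and [phi3_sum] counts relations by length, those
    of length 2 contributing omega_3(1) = 0.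

    Put e(i,j;k) = D T(x_i,x_j,x_k). It is alternating in i, j, satisfies Jacobi,
    vanishes when i, j, k lie in one R_p (c_p is central in the subgroup that the
    x_i, i in R_p, generate), and for i in R_p satisfies sum_(j in R_p) e(i,j;k) = 0,
    as [x_i, c_p] = 1. From these identities e = 0 is a combinatorial fact
    ([e_vanishes]). The graph enters only through the following: two
    triangles with a common edge carry two independent cycles, so b_1 <= 1 forces two
    adjacent vertices to have at most one common neighbour
    ([unique_common_neighbour]).

    Let k lie outside R_p, and call j in R_p exceptional if j and k lie in a common
    multiple relation. If i, j are both unexceptional then x_k commutes with x_i and
    x_j, and Jacobi gives e(i,j;k) = 0. If there is at most one exceptional j0, the
    sum relation for i also kills e(i,j0;k). The relations that join
    the exceptional indices to k are adjacent to one another and to p, so there are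
    at most two exceptional indices j0, j1, and p, q, r (with j0, k in R_q and j1, k
    in R_r) is then the only triangle through p and q. For i <> j0, j1 in R_p,
    Jacobi turns e(j0,i;k) into e(k,j0;i), and for the pair (q, i) the only
    possible exceptional index is j0, so this vanishes by the previous case. The
    same holds for j1, and the sum relation then kills e(j0,j1;k). *)

(** * The lower central series *)

Section LowerCentralSeries.
Local Open Scope group_scope.
Variable G : groupType.
Implicit Types (a b c d g h : G) (A : set G).

Lemma generatedJ A : (forall g d, A g -> A (g ^ d)) ->
  forall g d, generated A g -> generated A (g ^ d).
Proof.
move=> AJ g d; elim=> [h /AJ Ah||h1 h2 _ IH1 _ IH2|h _ IH].
- exact: generated_in.
- by rewrite conj1g; apply: generated_1.
- by rewrite conjMg; apply: generatedM.
- by rewrite conjVg; apply: generatedV.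
Qed.

Lemma lcsJ k g d : lcs k g -> lcs k (g ^ d).
Proof.
elim: k g d => [//|[//|k] IHk] g d; apply: generatedJ => {g d} g d.
case=> x [y [Hx _ ->]]; exists (x ^ d), (y ^ d); split=> //; first exact: IHk.
by rewrite conjRg.
Qed.

Lemma lcs1 k : @lcs G k 1.
Proof. by case: k => [//|[//|k]]; apply: generated_1. Qed.

Lemma lcsM k a b : lcs k a -> lcs k b -> lcs k (a * b).
Proof. by case: k => [//|[//|k]]; apply: generatedM. Qed.

Lemma lcsV k a : lcs k a -> lcs k a^-1.
Proof. by case: k => [//|[//|k]]; apply: generatedV. Qed.

Lemma lcs_commg k a d : lcs k a -> lcs k.+1 [~ a, d].
Proof. by case: k => [//|k] ka; apply: generated_in; exists a, d. Qed.

Lemma lcsS k a : lcs k.+1 a -> lcs k a.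
Proof.
case: k => [//|k]; elim=> [g [x [y [kx _ ->]]]|||].
- by rewrite commgEl; apply: lcsM; [apply: lcsV | apply: lcsJ].
- exact: lcs1.
- by move=> g h _ ? _; apply: lcsM.
- by move=> g _; apply: lcsV.
Qed.

End LowerCentralSeries.

(** * The graded pieces of the lower central series *)

Section GradedPiece.
Local Open Scope quotient_scope.
Local Open Scope group_scope.
Variables (k : nat) (G : groupType).

Definition lcs_elt : Type := {g : G | `[< lcs k g >]}.
HB.instance Definition _ := Choice.on lcs_elt.

Definition lcs_rel (a b : lcs_elt) : bool := `[< lcs k.+1 ((val a)^-1 * val b) >].

Lemma lcs_rel_equiv : equiv_class_of lcs_rel.
Proof.
split=> [a|a b|b a c]; rewrite /lcs_rel.
- by rewrite mulVg; apply/asboolP/lcs1.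
- by apply/asboolP/asboolP => /lcsV; rewrite invgM invgK.
- move=> /asboolP ab /asboolP bc; apply/asboolP.
  by have := lcsM ab bc; rewrite -mulgA mulVKg.
Qed.
Canonical lcs_equiv := EquivRelPack lcs_rel_equiv.

(** A genuine [zmodType], so that brackets can be computed with additively and
    with the generic lemmas on sums. *)
Definition gr : Type := {eq_quot lcs_rel}.
HB.instance Definition _ := Choice.on gr.

Definition to_lcs (g : G) : lcs_elt :=
  insubd (exist (fun g => `[< lcs k g >]) 1 (asboolT (@lcs1 G k))) g.

(** Total on [G], so that classes can be written without membership proofs;
    meaningful for [g] in [lcs k] only. *)
Definition cls (g : G) : gr := (\pi_({eq_quot lcs_rel}) (to_lcs g))%qT.
Definition rep (v : gr) : G := val (repr (v : {eq_quot lcs_rel})).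

Lemma lcs_rep v : lcs k (rep v).
Proof. exact/asboolP/(valP (repr (v : {eq_quot lcs_rel}))). Qed.

Lemma to_lcsK g : lcs k g -> val (to_lcs g) = g.
Proof. by move=> kg; rewrite /to_lcs val_insubd; case: ifP => // /asboolP. Qed.

Lemma repK : cancel rep cls.
Proof.
move=> v; rewrite /cls /rep.
have -> : to_lcs (val (repr (v : {eq_quot lcs_rel}))) = repr (v : {eq_quot lcs_rel}).
  by apply: val_inj; rewrite to_lcsK //; apply: lcs_rep.
exact: reprK.
Qed.

Lemma cls_eq a b : lcs k a -> lcs k b -> cls a = cls b <-> lcs k.+1 (a^-1 * b).
Proof.
move=> ka kb; rewrite /cls; split=> [/eqmodP|ab].
  by rewrite /= /lcs_rel !to_lcsK // => /asboolP.
by apply/eqmodP; rewrite /= /lcs_rel !to_lcsK //; apply/asboolP.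
Qed.

Lemma lcs_rep_cls a : lcs k a -> lcs k.+1 (a^-1 * rep (cls a)).
Proof. by move=> ka; apply/cls_eq; rewrite ?repK //; apply: lcs_rep. Qed.

Definition gr_add (u v : gr) : gr := cls (rep u * rep v).
Definition gr_opp (u : gr) : gr := cls (rep u)^-1.

Lemma cls_add a b : lcs k a -> lcs k b -> gr_add (cls a) (cls b) = cls (a * b).
Proof.
move=> ka kb; symmetry; apply/cls_eq; try by apply: lcsM => //; apply: lcs_rep.
set a' := rep _; set b' := rep _.
have -> : (a * b)^-1 * (a' * b') = (a^-1 * a') ^ b * (b^-1 * b').
  by rewrite conjgE invgM -!mulgA mulVKg.
by apply: lcsM; [apply: lcsJ|]; apply: lcs_rep_cls.
Qed.

Lemma cls_opp a : lcs k a -> gr_opp (cls a) = cls a^-1.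
Proof.
move=> ka; symmetry; apply/cls_eq; try by apply: lcsV => //; apply: lcs_rep.
set a' := rep _; rewrite invgK.
have -> : a * a'^-1 = (a^-1 * a')^-1 ^ a^-1.
  by rewrite conjgE invgM !invgK mulgK.
by apply/lcsJ/lcsV/lcs_rep_cls.
Qed.

Lemma gr_addA : associative gr_add.
Proof.
move=> u v w; rewrite -(repK u) -(repK v) -(repK w).
by rewrite !cls_add ?mulgA //; do ?apply: lcsM; apply: lcs_rep.
Qed.

Lemma gr_addC : commutative gr_add.
Proof.
move=> u v; apply/cls_eq; try by apply: lcsM; apply: lcs_rep.
have -> : (rep u * rep v)^-1 * (rep v * rep u) = [~ rep v, rep u].
  by rewrite invgM commgEl conjgE !mulgA.
exact/lcs_commg/lcs_rep.
Qed.

Lemma gr_add0 : left_id (cls 1) gr_add.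
Proof.
by move=> u; rewrite -(repK u) cls_add ?mul1g //; [apply: lcs1|apply: lcs_rep].
Qed.

Lemma gr_addN : left_inverse (cls 1) gr_opp gr_add.
Proof.
move=> u; rewrite -(repK u) cls_opp ?cls_add ?mulVg //; try exact: lcs_rep.
exact/lcsV/lcs_rep.
Qed.

HB.instance Definition _ := GRing.isZmodule.Build gr
  gr_addA gr_addC gr_add0 gr_addN.

Lemma clsM a b : lcs k a -> lcs k b -> cls (a * b) = (cls a + cls b)%R.
Proof. by move=> ka kb; rewrite -cls_add. Qed.
Lemma clsV a : lcs k a -> cls a^-1 = (- cls a)%R.
Proof. by move=> ka; rewrite -cls_opp. Qed.
Lemma cls1 : cls 1 = 0%R. Proof. by []. Qed.

Lemma cls_eq0 a : lcs k a -> cls a = 0%R <-> lcs k.+1 a.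
Proof.
move=> ka; rewrite -cls1 -[in X in _ <-> X](invgK a) -(mulg1 a^-1).
rewrite cls_eq ?mulg1 ?invgK //; last exact: lcs1.
by split=> /lcsV; rewrite ?invgK.
Qed.

Lemma clsJ a d : lcs k a -> cls (a ^ d) = cls a.
Proof.
move=> ka; symmetry; apply/cls_eq => //; first exact: lcsJ.
by rewrite -commgEl; apply: lcs_commg.
Qed.

End GradedPiece.

(** * Triple commutators *)

Section TripleCommutators.
Local Open Scope group_scope.
Variable G : groupType.
Implicit Types a b c d g : G.

Lemma commgMl a b d : [~ a * b, d] = [~ a, d] ^ b * [~ b, d].
Proof. by rewrite !commgEl !conjgE ?invgM -!mulgA ?mulKg ?mulVKg. Qed.

Lemma commgMr a b d : [~ a, b * d] = [~ a, d] * [~ a, b] ^ d.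
Proof. by rewrite !commgEl !conjgE ?invgM -!mulgA ?mulKg ?mulVKg. Qed.

Lemma lcs_comm2 a b : lcs 2 [~ a, b].
Proof. exact: (@lcs_commg G 1). Qed.

Lemma lcs_comm3 a b d : lcs 3 [~ a, b, d].
Proof. exact/lcs_commg/lcs_comm2. Qed.

Definition triple a b d : gr 3 G := cls 3 [~ a, b, d].

(** Modulo [lcs 4] conjugation is trivial on [lcs 3], so commutator identities
    lose their conjugations and become additive. *)
Lemma cls_commgMl g h d : lcs 2 g -> lcs 2 h ->
  cls 3 [~ g * h, d] = (cls 3 [~ g, d] + cls 3 [~ h, d])%R.
Proof.
move=> g2 h2; have g3 := lcs_commg d g2; have h3 := lcs_commg d h2.
by rewrite commgMl clsM ?clsJ //; apply: lcsJ.
Qed.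

Lemma cls_commg3 g d : lcs 3 g -> cls 3 [~ g, d] = 0%R.
Proof.
by move=> g3; apply/cls_eq0; [apply/lcsS/lcs_commg | apply: lcs_commg].
Qed.

Lemma cls_commgVl g d : lcs 2 g -> cls 3 [~ g^-1, d] = (- cls 3 [~ g, d])%R.
Proof.
move=> g2; apply/eqP; rewrite -subr_eq0 opprK -cls_commgMl //.
  by rewrite mulVg comm1g cls1.
exact: lcsV.
Qed.

Lemma triple_mul3 a b d d' : triple a b (d * d') = (triple a b d + triple a b d')%R.
Proof.
rewrite /triple commgMr clsM ?clsJ; first exact: addrC.
all: by try apply: lcsJ; apply: lcs_comm3.
Qed.

(** [a * a', b] differs from [a, b] * [a', b] by [[a, b], a'], which lies in
    [lcs 3] and hence is killed by one more commutator. *)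
Lemma triple_mul1 a a' b d : triple (a * a') b d = (triple a b d + triple a' b d)%R.
Proof.
rewrite /triple commgMl cls_commgMl; try by try apply: lcsJ; apply: lcs_comm2.
congr (_ + _)%R; rewrite -(mulVKg [~ a, b] ([~ a, b] ^ a')) -commgEl.
rewrite cls_commgMl ?(cls_commg3 d (lcs_comm3 _ _ _)) ?addr0 //.
  exact: lcs_comm2.
exact/lcsS/lcs_comm3.
Qed.

Lemma triple11 a d : triple a a d = 0%R.
Proof. by rewrite /triple commgg comm1g. Qed.

Lemma triple_antisym a b d : triple a b d = (- triple b a d)%R.
Proof. by rewrite /triple -(invgR b a) cls_commgVl //; apply: lcs_comm2. Qed.

Lemma triple_mul2 a b b' d : triple a (b * b') d = (triple a b d + triple a b' d)%R.
Proof.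
by rewrite triple_antisym triple_mul1 opprD -!(triple_antisym a).
Qed.

Lemma triple_one1 b d : triple 1 b d = 0%R.
Proof. by rewrite /triple !comm1g. Qed.
Lemma triple_one2 a d : triple a 1 d = 0%R.
Proof. by rewrite /triple commg1 comm1g. Qed.
Lemma triple_one3 a b : triple a b 1 = 0%R.
Proof. by rewrite /triple commg1. Qed.

Lemma triple_inv1 a b d : triple a^-1 b d = (- triple a b d)%R.
Proof.
by apply/eqP; rewrite -subr_eq0 opprK -triple_mul1 mulVg triple_one1.
Qed.
Lemma triple_inv2 a b d : triple a b^-1 d = (- triple a b d)%R.
Proof.
by apply/eqP; rewrite -subr_eq0 opprK -triple_mul2 mulVg triple_one2.
Qed.
Lemma triple_inv3 a b d : triple a b d^-1 = (- triple a b d)%R.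
Proof.
by apply/eqP; rewrite -subr_eq0 opprK -triple_mul3 mulVg triple_one3.
Qed.

Lemma hall_witt a b d :
  [~ a, b^-1, d] ^ b * [~ b, d^-1, a] ^ d * [~ d, a^-1, b] ^ a = 1.
Proof.
rewrite !commgEl !conjgE !invgM !invgK -!mulgA.
by rewrite ?(mulKg, mulVKg, mulVg, mulgV, mulg1, mul1g).
Qed.

Lemma triple_jacobi a b d : (triple a b d + triple b d a + triple d a b = 0)%R.
Proof.
have sum0 u v w : lcs 3 u -> lcs 3 v -> lcs 3 w ->
    u ^ b * v ^ d * w ^ a = 1 -> (cls 3 u + cls 3 v + cls 3 w = 0)%R.
  move=> u3 v3 w3 /(congr1 (@cls 3 G)).
  have [u3b v3d w3a] : [/\ lcs 3 (u ^ b), lcs 3 (v ^ d) & lcs 3 (w ^ a)].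
    by split; apply: lcsJ.
  by rewrite (clsM (lcsM u3b v3d) w3a) (clsM u3b v3d) !clsJ.
have := sum0 _ _ _ (lcs_comm3 _ _ _) (lcs_comm3 _ _ _) (lcs_comm3 _ _ _)
  (hall_witt a b d).
rewrite -/(triple a b^-1 d) -/(triple b d^-1 a) -/(triple d a^-1 b).
rewrite !triple_inv2 -!opprD => /eqP.
by rewrite oppr_eq0 => /eqP.
Qed.

Lemma triple_commute a b d : commute a b -> triple a b d = 0%R.
Proof. by move/commgP/eqP => ab; rewrite /triple ab comm1g. Qed.

Lemma triple_commute3 (a b z : G) : commute a z -> commute b z -> triple a b z = 0%R.
Proof.
move=> /commute_sym az /commute_sym bz.
have /commgP/eqP E : commute [~ a, b] z.
  by apply: commute_sym; do ?[apply: commuteM | apply: commuteV].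
by rewrite /triple E.
Qed.

(** In every other term of the trilinear expansion, either the first two entries
    commute or the third commutes with both of them. *)
Lemma triple_mul_commuting (a b d z z' z'' : G) :
    commute a z' -> commute z b -> commute z z' ->
    commute a z'' -> commute b z'' -> commute z z'' -> commute z' z'' ->
  triple (a * z) (b * z') (d * z'') = triple a b d.
Proof.
move=> az' zb zz' az'' bz'' zz'' z'z''.
have commuteMl (u v y : G) : commute u y -> commute v y -> commute (u * v) y.
  by move=> /commute_sym uy /commute_sym vy; apply/commute_sym; apply: commuteM.
rewrite triple_mul3 [X in (_ + X)%R]triple_commute3 ?addr0; try exact: commuteMl.
rewrite triple_mul1 (triple_commute d (commuteM zb zz')) addr0.
by rewrite triple_mul2 (triple_commute _ az') addr0.
Qed.

Lemma triple_prod2 (I : Type) (s : seq I) (F : I -> G) a d :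
  triple a (\prod_(i <- s) F i) d = (\sum_(i <- s) triple a (F i) d)%R.
Proof.
apply: (big_morph (fun b => triple a b d)); last exact: triple_one2.
by move=> b b'; apply: triple_mul2.
Qed.

(** If at most one of the [y i] is nontrivial, a bracket has a trivial entry or
    two equal first entries. *)
Lemma triple_single (I : eqType) (A : {pred I}) (y : I -> G) :
    (exists i0, forall i, i \in A -> i != i0 -> y i = 1) ->
  forall i j k, i \in A -> j \in A -> triple (y i) (y j) (y k) = 0%R.
Proof.
case=> i0 yi0 i j k iA jA.
have [->|ii0] := eqVneq i i0; last by rewrite (yi0 i) // triple_one1.
have [->|ji0] := eqVneq j i0; first exact: triple11.
by rewrite (yi0 j) // triple_one2.
Qed.

(** Trilinearity lets a generating set [X] replace [G] in each slot in turn, so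
    the brackets of elements of [X] span; as an induction principle, this serves
    both to bound ranks and to compare additive maps. *)
Lemma gr3_ind (X : set G) (S : gr 3 G -> Prop) :
    (forall g, generated X g) ->
    S 0%R -> (forall u v, S u -> S v -> S (u + v)%R) ->
    (forall u, S u -> S (- u)%R) ->
    (forall a b d, X a -> X b -> X d -> S (triple a b d)) ->
  forall v, S v.
Proof.
move=> Xgen S0 SD SN SX.
have S1 a b d : X b -> X d -> S (triple a b d).
  move=> Xb Xd; elim: (Xgen a) => [g Xg||g h _ Sg _ Sh|g _ Sg].
  - exact: SX.
  - by rewrite triple_one1.
  - by rewrite triple_mul1; apply: SD.
  - by rewrite triple_inv1; apply: SN.
have S2 a b d : X d -> S (triple a b d).
  move=> Xd; elim: (Xgen b) => [g Xg||g h _ Sg _ Sh|g _ Sg].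
  - exact: S1.
  - by rewrite triple_one2.
  - by rewrite triple_mul2; apply: SD.
  - by rewrite triple_inv2; apply: SN.
have S3 a b d : S (triple a b d).
  elim: (Xgen d) => [g Xg||g h _ Sg _ Sh|g _ Sg].
  - exact: S2.
  - by rewrite triple_one3.
  - by rewrite triple_mul3; apply: SD.
  - by rewrite triple_inv3; apply: SN.
have S4 g d : lcs 2 g -> S (cls 3 [~ g, d]).
  elim=> [h [x [y [_ _ ->]]]||g1 g2 l1 IH1 l2 IH2|g1 l1 IH1].
  - exact: S3.
  - by rewrite comm1g.
  - by rewrite cls_commgMl //; apply: SD.
  - by rewrite cls_commgVl //; apply: SN.
move=> v; rewrite -(repK v); move: (rep v) (lcs_rep v) => g.
elim=> [h [x [y [x2 _ ->]]]||g1 g2 l1 IH1 l2 IH2|g1 l1 IH1].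
- exact: S4.
- by rewrite cls1.
- by rewrite clsM //; apply: SD.
- by rewrite clsV //; apply: SN.
Qed.

End TripleCommutators.

(** * Functoriality *)

Section GradedMap.
Local Open Scope group_scope.
Variables (G H : groupType) (f : UMagmaMorphism.type G H).

Lemma lcs_morph k g : lcs k g -> lcs k (f g).
Proof.
elim: k g => [//|[//|k] IHk] g; elim=> [h [x [y [kx _ ->]]]|||].
- by rewrite gmulfR; apply/lcs_commg/IHk.
- by rewrite gmulf1; apply: lcs1.
- by move=> a b _ fa _ fb; rewrite gmulfM; apply: lcsM.
- by move=> a _ fa; rewrite gmulfV; apply: lcsV.
Qed.

Variable k : nat.

(** Defined through representatives; by [gr_map_cls] their choice is immaterial. *)
Definition gr_map (v : gr k G) : gr k H := cls k (f (rep v)).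

Lemma gr_map_cls g : lcs k g -> gr_map (cls k g) = cls k (f g).
Proof.
move=> kg; symmetry; apply/cls_eq; try by apply: lcs_morph; try exact: lcs_rep.
by rewrite -gmulfV -gmulfM; apply/lcs_morph/lcs_rep_cls.
Qed.

Lemma gr_map_is_nmod : GRing.nmod_morphism gr_map.
Proof.
split=> [|u v]; first by rewrite -cls1 gr_map_cls ?gmulf1 //; apply: lcs1.
rewrite -(repK u) -(repK v) -clsM ?gr_map_cls ?gmulfM ?clsM //.
all: by do ?[exact: lcs_rep | apply: lcs_morph | apply: lcsM].
Qed.

HB.instance Definition _ := GRing.isNmodMorphism.Build (gr k G) (gr k H) gr_map
  gr_map_is_nmod.

End GradedMap.

Lemma gr_map_triple (G H : groupType) (f : UMagmaMorphism.type G H) (a b d : G) :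
  gr_map f (triple a b d) = triple (f a) (f b) (f d).
Proof. by rewrite gr_map_cls ?gmulfR //; apply: lcs_comm3. Qed.

(** * Ranks of abelian groups *)

Section Rank.
Local Open Scope ring_scope.

Definition free_family (M : zmodType) (I : finType) (a : I -> M) : Prop :=
  forall c : I -> int, \sum_i a i *~ c i = 0 -> forall i, c i = 0.

(** Membership of [v] in the span of [a] after tensoring with the rationals. *)
Definition rationally_spans (M : zmodType) (I : finType) (a : I -> M) (v : M) : Prop :=
  exists (d : int) (c : I -> int), d != 0 /\ v *~ d = \sum_i a i *~ c i.

Definition rational_basis (M : zmodType) (I : finType) (a : I -> M) : Prop :=
  free_family a /\ forall v, rationally_spans a v.

(** A rational vector of the left kernel, cleared of its denominators. *)
Lemma int_left_kernel r s (A : 'M[int]_(r, s)) : (s < r)%N ->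
  exists c : 'I_r -> int, (exists i, c i != 0) /\
    forall j, \sum_i c i * A i j = 0.
Proof.
move=> sr; pose B : 'M[rat]_(r, s) := map_mx intr A.
have /rowV0Pn[v /sub_kermxP vB vn0] : kermx B != 0.
  rewrite -mxrank_eq0 mxrank_ker subn_eq0 -ltnNge.
  exact: leq_ltn_trans (rank_leq_col B) sr.
pose d := \prod_i denq (v 0 i).
pose c i := numq (v 0 i) * \prod_(j | j != i) denq (v 0 j).
have cE i : (c i)%:~R = v 0 i * d%:~R :> rat.
  rewrite /d (bigD1 i) //= /c !intrM mulrA.
  by rewrite -{2}[v 0 i]divq_num_den divfK // intr_eq0 denq_eq0.
have dn0 : d%:~R != 0 :> rat.
  by rewrite intr_eq0; apply/prodf_neq0 => i _; apply: denq_neq0.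
exists c; split.
  have /rV0Pn[i vi] := vn0; exists i.
  by rewrite -(intr_eq0 rat) cE mulf_neq0.
move=> j; apply/eqP; rewrite -(intr_eq0 rat) rmorph_sum /=; apply/eqP.
have := congr1 (fun u : 'rV_s => u 0 j * d%:~R) vB; rewrite !mxE mul0r.
rewrite mulr_suml => vB0; apply: etrans vB0; apply: eq_bigr => i _.
by rewrite intrM cE !mxE mulrAC.
Qed.

(** Exchange over the rationals: multiples of the [b j] are given by an integer matrix
    with [#|J|] rows and [#|I|] columns, and a left kernel vector of it would be a
    relation between the [b j]. *)
Lemma free_family_card (M : zmodType) (I J : finType) (a : I -> M) (b : J -> M) :
  free_family b -> (forall j, rationally_spans a (b j)) -> (#|J| <= #|I|)%N.
Proof.
move=> bfree ab; rewrite leqNgt; apply/negP => IJ.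
have /choice[d /choice[c dc]] := ab.
pose A := \matrix_(i < #|J|, j < #|I|) c (enum_val i) (enum_val j).
have [z [[i zi] zA]] := int_left_kernel A IJ.
suff /bfree/(_ (enum_val i))/eqP : \sum_j b j *~ (d j * z (enum_rank j)) = 0.
  by rewrite enum_valK mulf_eq0 (negPf zi) orbF; have [/negPf ->] := dc (enum_val i).
rewrite (eq_bigr (fun j => \sum_i a i *~ (z (enum_rank j) * c j i))); last first.
  move=> j _; rewrite mulrzA; have [_ ->] := dc j.
  by rewrite mulrz_suml; apply: eq_bigr => k _; rewrite mulrC mulrzA.
rewrite exchange_big big1 //= => k _; rewrite -mulrz_sumr.
rewrite (reindex (@enum_val _ J)) /=; last exact/onW_bij/enum_val_bij.
rewrite -[RHS](mulr0z (a k)) -[in RHS](zA (enum_rank k)); congr (_ *~ _).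
by apply: eq_bigr => l _; rewrite mxE enum_rankK enum_valK.
Qed.

(** A free family of maximal size rationally spans: adjoining [v] to it makes it
    dependent, and the coefficient of [v] cannot be 0. *)
Lemma rational_basis_exists (M : zmodType) (I : finType) (a : I -> M) :
    (forall v, rationally_spans a v) ->
  exists r (b : 'I_r -> M), rational_basis b.
Proof.
move=> aspan.
pose P r := `[< exists b : 'I_r -> M, free_family b >].
have P0 : exists r, P r.
  exists 0%N; apply/asboolP; exists (fun=> 0) => c _ i; by have := ltn_ord i.
have Pmax r : P r -> (r <= #|I|)%N.
  by case/asboolP=> b bf; rewrite -[r]card_ord; apply: (free_family_card bf).
have [r /asboolP[b bf] rmax] := ex_maxnP P0 Pmax.
exists r, b; split=> // v.
have : ~ free_family (fun i => if unlift ord_max i is Some j then b j else v).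
  move=> vbf; suff /rmax : P r.+1 by rewrite ltnn.
  by apply/asboolP; exists (fun i => if unlift ord_max i is Some j then b j else v).
move/existsNP=> [c /not_implyP[]].
rewrite big_ord_recr /= unlift_none => c0 /existsNP[i /eqP ci].
have liftE (j : 'I_r) : widen_ord (leqnSn r) j = lift ord_max j.
  by apply: val_inj; rewrite /= /bump leqNgt ltn_ord.
move: c0; under eq_bigr do rewrite liftE liftK.
move=> c0; exists (c ord_max), (fun j => - c (lift ord_max j)); split.
  apply: contraNneq ci => cv; move: c0; rewrite cv mulr0z addr0 => /bf c0.
  by have [j ->|->] := unliftP ord_max i; [rewrite c0 | apply/eqP].
under eq_bigr do rewrite mulrNz; rewrite sumrN.
by apply/eqP; rewrite -addr_eq0 addrC; apply/eqP.
Qed.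

(** The maps [s p] and [f p] present [M] as the direct sum of the [N p]; applying
    [f q] to a relation isolates its q-th component. *)
Lemma rational_basis_direct_sum (P : finType) (M : zmodType) (N : P -> zmodType)
    (f : forall p, {additive M -> N p}) (s : forall p, {additive N p -> M})
    (I : P -> finType) (a : forall p, I p -> N p) :
    (forall p v, f p (s p v) = v) ->
    (forall p q v, p != q -> f q (s p v) = 0) ->
    (forall v, v = \sum_p s p (f p v)) ->
    (forall p, rational_basis (a p)) ->
  rational_basis (fun u : {p : P & I p} => s (tag u) (a (tag u) (tagged u))).
Proof.
move=> fs fs0 sf ab; split=> [c c0 [q i]|v].
  have [aq _] := ab q; apply: (aq (fun i => c (Tagged I i))) i.
  have : \sum_p \sum_i s p (a p i) *~ c (Tagged I i) = 0.
    rewrite (sig_big_dep xpredT (fun _ => xpredT)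
      (fun p i => s p (a p i) *~ c (Tagged I i))) /= -[RHS]c0.
    by apply: eq_bigr => -[].
  move/(congr1 (f q)).
  rewrite (bigD1 q) //= raddfD raddf0 !raddf_sum /= [X in _ + X]big1 => [|p pq].
    rewrite addr0 => cq0; rewrite -[RHS]cq0.
    by apply: eq_bigr => i _; rewrite raddfMz fs.
  by rewrite raddf_sum big1 //= => i _; rewrite raddfMz fs0 ?mul0rz.
pose d p := projT1 (cid ((ab p).2 (f p v))).
have dP p : exists c, d p != 0 /\ f p v *~ d p = \sum_i a p i *~ c i.
  exact: projT2 (cid ((ab p).2 (f p v))).
pose c p := projT1 (cid (dP p)).
have cP p : d p != 0 /\ f p v *~ d p = \sum_i a p i *~ c p i.
  exact: projT2 (cid (dP p)).
(* [d p] clears the denominators in the p-th summand; [\prod_p d p] does so in all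
   of them. *)
exists (\prod_p d p), (fun u => c (tag u) (tagged u) * \prod_(q | q != tag u) d q).
split; first by apply/prodf_neq0 => p _; have [] := cP p.
transitivity (\sum_p \sum_i s p (a p i) *~ (c p i * \prod_(q | q != p) d q)); last first.
  by rewrite (sig_big_dep xpredT (fun _ => xpredT)
    (fun p i => s p (a p i) *~ (c p i * \prod_(q | q != p) d q))).
rewrite {1}(sf v) mulrz_suml; apply: eq_bigr => p _.
rewrite (bigD1 p) //= mulrzA -raddfMz; have [_ ->] := cP p.
rewrite raddf_sum mulrz_suml; apply: eq_bigr => i _.
by rewrite raddfMz mulrzA.
Qed.

End Rank.

(** * The rank of a graded piece *)

Section PhiRank.
Variable G : groupType.

Lemma lcs_zexpg k (g : G) z : lcs k g -> lcs k (zexpg g z).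
Proof.
move=> kg; have kX m : lcs k (g ^+ m)%g.
  by elim: m => [|m IHm]; [apply: lcs1 | rewrite expgS; apply: lcsM].
by case: z => m /=; [apply: kX | apply/lcsV/kX].
Qed.

Lemma cls_zexpg k (g : G) z : lcs k g -> cls k (zexpg g z) = (cls k g *~ z)%R.
Proof.
move=> kg; have kX m : lcs k (g ^+ m)%g by apply: (@lcs_zexpg _ _ (Posz m)).
have clsX m : cls k (g ^+ m)%g = (cls k g *+ m)%R.
  by elim: m => [|m IHm]; rewrite ?cls1 // expgS clsM // IHm mulrS.
by case: z => m /=; rewrite ?clsV // clsX.
Qed.

Lemma cls_prod k (I : Type) (s : seq I) (F : I -> G) : (forall i, lcs k (F i)) ->
  lcs k (\prod_(i <- s) F i)%g /\
  cls k (\prod_(i <- s) F i)%g = (\sum_(i <- s) cls k (F i))%R.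
Proof.
move=> kF; elim: s => [|i s [ks IHs]].
  by rewrite !big_nil; split=> //; apply: lcs1.
by rewrite !big_cons clsM // IHs; split=> //; apply: lcsM.
Qed.

Lemma has_independent_mod_gr k r :
  has_independent_mod (@lcs G k) (@lcs G k.+1) r <->
  exists a : 'I_r -> gr k G, free_family a.
Proof.
have prodE (a : 'I_r -> G) (c : 'I_r -> int) : (forall i, lcs k (a i)) ->
    lcs k.+1 (\prod_(i < r) zexpg (a i) (c i))%g <->
    (\sum_i cls k (a i) *~ c i = 0)%R.
  move=> ka; have kz i : lcs k (zexpg (a i) (c i)) by apply: lcs_zexpg.
  have [kp pE] := @cls_prod k _ (index_enum 'I_r) _ kz.
  rewrite -(cls_eq0 kp) pE; under [in X in _ <-> X]eq_bigr do rewrite -cls_zexpg //.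
  by [].
split=> [[a [ka afree]]|[a afree]].
  by exists (fun i => cls k (a i)) => c ac; apply/afree/(prodE a c ka).
exists (fun i => rep (a i)); split=> [i|c]; first exact: lcs_rep.
move/prodE => /(_ (fun i => lcs_rep (a i))) ac; apply: afree.
by apply: etrans ac; apply: eq_bigr => i _; rewrite repK.
Qed.

(** The maximum in the definition of [phi] is attained by any rational basis, since
    [free_family_card] bounds the size of all free families by its size. *)
Lemma phi_rational_basis k (I : finType) (a : I -> gr k G) :
  rational_basis a -> phi k G = #|I|.
Proof.
case=> afree aspan.
have aI : has_independent_mod (@lcs G k) (@lcs G k.+1) #|I|.
  apply/has_independent_mod_gr; exists (a \o enum_val) => c.
  rewrite (reindex enum_rank) /=; last exact/onW_bij/enum_rank_bij.
  under eq_bigr do rewrite enum_rankK.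
  by move/(afree (c \o enum_rank)) => ac i; rewrite -(enum_valK i); apply: ac.
have maxI r : has_independent_mod (@lcs G k) (@lcs G k.+1) r -> (r <= #|I|)%N.
  case/has_independent_mod_gr => b bfree.
  by rewrite -[r]card_ord; apply: (free_family_card (a := a) bfree).
apply: xget_unique => [|r [rI rmax]]; first by split.
by apply/eqP; rewrite eqn_leq maxI //= rmax.
Qed.

Lemma gr3_spanned n (x : 'I_n -> G) : (forall g, generated (range x) g) ->
  forall v, rationally_spans
    (fun i : 'I_n * 'I_n * 'I_n => triple (x i.1.1) (x i.1.2) (x i.2)) v.
Proof.
move=> xgen.
suff span v : exists c : 'I_n * 'I_n * 'I_n -> int,
    v = (\sum_i triple (x i.1.1) (x i.1.2) (x i.2) *~ c i)%R.
  by move=> v; have [c vE] := span v; exists 1%R, c; rewrite mulr1z.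
move: v; apply: (gr3_ind xgen) => [|u v [c ->] [c' ->]|u [c ->]|a b d].
- by exists (fun=> 0%R); rewrite big1.
- exists (fun i => (c i + c' i)%R); rewrite -big_split.
  by apply: eq_bigr => i _; rewrite mulrzDr.
- by exists (fun i => (- c i)%R); rewrite -sumrN; apply: eq_bigr => i _; rewrite mulrNz.
case=> i _ <- [j _ <-] [k _ <-].
exists (fun u => ((u == (i, j, k)) : nat)%:R%R).
rewrite (bigD1 (i, j, k)) //= eqxx mulr1z big1 ?addr0 // => u /negPf ->.
by rewrite mulr0z.
Qed.

Lemma gr3_rational_basis_exists n (x : 'I_n -> G) :
  (forall g, generated (range x) g) ->
  exists r (a : 'I_r -> gr 3 G), rational_basis a.
Proof. by move/gr3_spanned; apply: rational_basis_exists. Qed.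

Lemma free_lift_generated n (x : 'I_n -> G) s : generated (range x) (free_lift x s).
Proof.
rewrite /free_lift; elim: (word s) => [|[i b] t IHt].
  by rewrite big_nil; apply: generated_1.
rewrite big_cons; apply: generatedM => //=.
by case: b; [apply: generatedV|]; apply: generated_in; exists i.
Qed.

End PhiRank.

Section FreeGroupGenerators.
Variable n : nat.

Lemma free_lift_free_gen (s : free_group n) : free_lift (@free_gen n) s = s.
Proof.
case: s => s rs; apply: val_inj; rewrite /free_lift /=.
elim: s rs => [|[i b] s IHs] rs; first by rewrite big_nil.
rewrite big_cons /= IHs; last exact: path_sorted rs.
by case: b rs => /=; case: s {IHs} => [|m s] //= /andP[/negPf ->].
Qed.

Lemma free_group_generated (s : free_group n) : generated (range (@free_gen n)) s.
Proof. by rewrite -(free_lift_free_gen s); apply: free_lift_generated. Qed.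

End FreeGroupGenerators.

(** All brackets of a single generator vanish. *)
Lemma omega3_1 : omega 3 1 = 0%N.
Proof.
have gr0 (v : gr 3 (free_group 1)) : v = 0%R.
  move: v; apply: (gr3_ind (@free_group_generated 1)) => [//|u v -> ->|u ->|a b d].
  - exact: addr0.
  - exact: oppr0.
  by case=> i _ <- [j _ <-] _; rewrite !ord1 triple11.
rewrite /omega (@phi_rational_basis _ 3 void (of_void _)) ?card_void //.
split=> [c _ []|v]; exists 1%R, (fun=> 0%R).
by split=> //; rewrite (gr0 (v *~ 1)%R) (gr0 (\sum_i _)%R).
Qed.

(** * Cycles in graphs *)

Section Diamond.
Local Open Scope ring_scope.
Variables (T : finType) (e : rel T).
Hypotheses (esym : symmetric e) (eirr : irreflexive e).

Let edge := oriented_edges e.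

(** The edge from [u] to [v] as a 1-chain, with sign -1 if the graph orients it
    the other way. *)
Definition edge_row (u v : T) : 'rV[rat]_#|edge| :=
  \row_i ((enum_val i == (u, v))%:R - (enum_val i == (v, u))%:R).

(** Chains are integrated against antisymmetric functions of oriented edges, which
    hides the choice of orientations. Both the boundary and the pairing of two edges are
    of this kind. *)
Lemma edge_row_pairing (g : T * T -> rat) u v : (forall a b, g (b, a) = - g (a, b)) ->
  e u v -> \sum_i edge_row u v 0 i * g (enum_val i) = g (u, v).
Proof.
move=> gN euv.
have pick_edge w : \sum_(z in edge) (z == w)%:R * g z = (w \in edge)%:R * g w.
  rewrite big_mkcond (bigD1 w) //= eqxx mul1r big1 ?addr0 => [|z /negPf ->].
    by case: (w \in edge); rewrite ?mul1r ?mul0r.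
  by rewrite mul0r if_same.
under eq_bigr do rewrite mxE mulrBl.
rewrite sumrB -(big_enum_val (fun z => (z == (u, v))%:R * g z)).
rewrite -(big_enum_val (fun z => (z == (v, u))%:R * g z)) !pick_edge.
rewrite !inE /= (esym v) euv /= (gN u v).
have uv : u != v by apply: contraTneq euv => ->; rewrite eirr.
case: (ltngtP (enum_rank u) (enum_rank v)) => [_|_|/val_inj/enum_rank_inj/eqP].
- by rewrite mul1r mul0r subr0.
- by rewrite mul1r mul0r sub0r opprK.
- by rewrite (negPf uv).
Qed.

Lemma edge_row_boundary u v : e u v ->
  edge_row u v *m boundary_mx e =
  \row_j ((enum_val j == v)%:R - (enum_val j == u)%:R).
Proof.
move=> euv; apply/rowP => j; rewrite !mxE.
pose g (w : T * T) : rat := (enum_val j == w.2)%:R - (enum_val j == w.1)%:R.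
have gN a b : g (b, a) = - g (a, b) by rewrite /g opprB.
apply: etrans (edge_row_pairing gN euv); apply: eq_bigr => i _.
by rewrite [boundary_mx _ _ _]mxE.
Qed.

Definition triangle_row (a b c : T) := edge_row a b + edge_row b c + edge_row c a.

Lemma triangle_row_boundary a b c : e a b -> e b c -> e c a ->
  triangle_row a b c *m boundary_mx e = 0.
Proof.
move=> ab bc ca; rewrite /triangle_row !mulmxDl !edge_row_boundary //.
by apply/rowP => j; rewrite !mxE; ring.
Qed.

(** The two triangles on the edge [p q] are independent cycles: pairing them with
    the edges [p r] and [p s], each in only one of the triangles, gives minus the
    identity matrix. *)
Lemma betti1_diamond p q r s : e p q -> e p r -> e q r -> e p s -> e q s ->
  r != s -> (2 <= betti1 e)%N.
Proof.
move=> pq pr qr ps qs rs.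
have neq u v : e u v -> u == v = false.
  by move=> uv; apply: contraTF uv => /eqP ->; rewrite eirr.
pose h a b (w : T * T) : rat := (w == (a, b))%:R - (w == (b, a))%:R.
have hN a b u v : h a b (v, u) = - h a b (u, v).
  by rewrite /h opprB !xpair_eqE (andbC (v == a)) (andbC (v == b)).
have pairE a b u v : e u v -> edge_row u v *m (edge_row a b)^T = (h a b (u, v))%:M.
  move=> uv; apply/rowP => i; rewrite !ord1 !mxE eqxx mulr1n.
  apply: etrans (edge_row_pairing (hN a b) uv); apply: eq_bigr => k _.
  by congr (_ * _); rewrite !mxE.
pose M := col_mx (triangle_row p q r) (triangle_row p q s).
pose N := row_mx (edge_row p r)^T (edge_row p s)^T.
have MN : M *m N = - 1%:M.
  rewrite mul_col_row scalar_mx_block opp_block_mx oppr0 /triangle_row.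
  rewrite !mulmxDl !pairE //; try by rewrite esym.
  have [rs0 sr0] : (r == s = false) /\ (s == r = false).
    by rewrite (eq_sym s) (negPf rs).
  rewrite /h !xpair_eqE !eqxx rs0 sr0.
  rewrite !(neq _ _ pq, neq _ _ pr, neq _ _ ps, neq _ _ qr, neq _ _ qs).
  rewrite ![_ == p]eq_sym !(neq _ _ pr, neq _ _ pq, neq _ _ ps) /=.
  rewrite ?mulr0n ?subr0 ?sub0r.
  by rewrite !raddf0 !add0r raddfN.
have Mker : (M <= kermx (boundary_mx e))%MS.
  have [rp sp] : e r p /\ e s p by rewrite ![e _ p]esym.
  by apply/sub_kermxP; rewrite mul_col_mx !triangle_row_boundary ?col_mx0.
apply: leq_trans (mxrankS Mker); apply: leq_trans (mxrankM_maxl M N).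
by rewrite MN mxrank_opp mxrank1.
Qed.

End Diamond.

(** * Vanishing of the nonlocal triple brackets *)

Section Vanishing.
Local Open Scope ring_scope.
Variables (n w : nat) (R : 'I_w -> {set 'I_n}).
Hypothesis R_pair : forall j1 j2 : 'I_n, j1 != j2 ->
  exists! p : 'I_w, [set j1; j2] \subset R p.
Hypothesis R_betti : (betti1 (Gr R) <= 1)%N.

Let mult p := (3 <= #|R p|)%N.

Lemma relation_exists i j : i != j -> exists p, i \in R p /\ j \in R p.
Proof.
by move=> /R_pair[p [+ _]]; rewrite finset.subUset !finset.sub1set => /andP[]; exists p.
Qed.

Lemma relation_unique p q i j : i != j ->
  i \in R p -> j \in R p -> i \in R q -> j \in R q -> p = q.
Proof.
move=> /R_pair[s [_ sU]] ip jp iq jq.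
by rewrite -(sU p) ?(sU q) // finset.subUset !finset.sub1set ?ip ?iq.
Qed.

(** The vertices [r] and [s] are common neighbours of the adjacent vertices [p] and
    [q]; the remaining indices witness the five edges. *)
Lemma unique_common_neighbour p q r s a b c a' b' :
    mult p -> mult q -> mult r -> mult s ->
    p != q -> p != r -> q != r -> p != s -> q != s ->
    a \in R p -> a \in R q -> b \in R p -> b \in R r -> c \in R q -> c \in R r ->
    a' \in R p -> a' \in R s -> b' \in R q -> b' \in R s ->
  r = s.
Proof.
move=> mp mq mr ms pq pr qr ps qs ap aq bp br cq cr a'p a's b'q b's.
have GrP u v (mu : mult u) (mv : mult v) i : u != v -> i \in R u -> i \in R v ->
    Gr R (exist _ u mu) (exist _ v mv).
  move=> uv iu iv; rewrite /Gr -(inj_eq val_inj) /= uv /=.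
  apply/cards1P; exists i; apply/finset.setP => j; rewrite !inE.
  apply/andP/eqP => [[ju jv]|-> //]; apply/eqP/negPn/negP => ji.
  by case/negP: uv; apply/eqP; apply: (relation_unique ji).
apply/eqP/negPn/negP => rs; move: R_betti; rewrite leqNgt => /negP; apply.
apply: (@betti1_diamond _ (Gr R) _ _
  (exist _ p mp) (exist _ q mq) (exist _ r mr) (exist _ s ms)).
- by move=> u v; rewrite /Gr eq_sym finset.setIC.
- by move=> u; rewrite /Gr eqxx.
- exact: GrP pq ap aq.
- exact: GrP pr bp br.
- exact: GrP qr cq cr.
- exact: GrP ps a'p a's.
- exact: GrP qs b'q b's.
- by rewrite -(inj_eq val_inj).
Qed.

(** [e i j k] plays the part of D T(x_i,x_j,x_k). *)
Variables (M : zmodType) (e : 'I_n -> 'I_n -> 'I_n -> M).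
Hypothesis e_diag : forall i k, e i i k = 0.
Hypothesis e_antisym : forall i j k, e i j k = - e j i k.
Hypothesis e_jacobi : forall i j k, e i j k + e j k i + e k i j = 0.
Hypothesis e_local : forall p i j k,
  i \in R p -> j \in R p -> k \in R p -> e i j k = 0.
Hypothesis e_sum : forall p i k, i \in R p -> \sum_(j in R p) e i j k = 0.

(* In the application, x_i and x_j then commute. *)
Let simple_pair i j := forall q, i \in R q -> j \in R q -> ~~ mult q.

(** The sum relation of a relation of length 2 has a single nondiagonal term. *)
Lemma e_simple_pair i j k : simple_pair i j -> e i j k = 0.
Proof.
move=> sij; have [->|ij] := eqVneq i j; first exact: e_diag.
have [p [ip jp]] := relation_exists ij.
have Rp : R p = [set i; j].
  apply/esym/eqP; rewrite eqEcard finset.subUset !finset.sub1set ip jp cards2 ij /=.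
  by rewrite leqNgt; apply: sij.
by have := e_sum k ip; rewrite Rp big_setU1 ?inE //= big_set1 e_diag add0r.
Qed.

Lemma simple_pairC i j : simple_pair i j -> simple_pair j i.
Proof. by move=> sij q jq iq; apply: sij. Qed.

Lemma e_two_simple_pairs i j k : simple_pair i k -> simple_pair j k -> e i j k = 0.
Proof.
move=> /simple_pairC ki jk; have := e_jacobi i j k.
by rewrite (e_simple_pair _ jk) (e_simple_pair _ ki) !addr0.
Qed.

(** Brackets avoiding [j0] vanish by Jacobi; the sum relation for [i] then has
    [e i j0 k] as its only remaining term. *)
Lemma e_one_exception p k j0 :
    (forall j, j \in R p -> j != j0 -> simple_pair j k) ->
  forall i j, i \in R p -> j \in R p -> e i j k = 0.
Proof.
move=> simp.
have e_j0 i : i \in R p -> j0 \in R p -> i != j0 -> e i j0 k = 0.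
  move=> ip j0p ij0; have := e_sum k ip.
  rewrite (bigD1 j0) //= big1 ?addr0 // => j /andP[jp jj0].
  by apply: e_two_simple_pairs; apply: simp.
move=> i j ip jp; have [->|ij] := eqVneq i j; first exact: e_diag.
have [jj0|jj0] := eqVneq j j0; first by rewrite jj0 e_j0 -?jj0.
have [ij0|ij0] := eqVneq i j0.
  by rewrite ij0 e_antisym e_j0 ?oppr0 // -ij0.
by apply: e_two_simple_pairs; apply: simp.
Qed.

(** Here [p], [q], [r] form a triangle. Since [r] is the only common neighbour of
    [p] and [q], no multiple relation joins [i] to an index of [R q] other than [j0];
    hence Jacobi reduces [e j0 i k] to [e k j0 i], for which [j0] is the only
    possible exception. *)
Lemma e_two_exceptions p q r j0 j1 k i :
    mult p -> mult q -> mult r -> k \notin R p -> j0 != j1 ->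
    j0 \in R p -> j1 \in R p -> j0 \in R q -> k \in R q -> j1 \in R r -> k \in R r ->
    i \in R p -> i != j1 ->
  (i != j0 -> simple_pair i k) /\ e j0 i k = 0.
Proof.
move=> mp mq mr kp j01 j0p j1p j0q kq j1r kr ip ij1.
have pq : p != q by apply: contraNneq kp => ->.
have pr : p != r by apply: contraNneq kp => ->.
have qr : q != r.
  apply: contraNneq pq => qr; rewrite qr in j0q.
  by rewrite qr; apply/eqP; apply: (relation_unique j01).
have [->|ij0] := eqVneq i j0; first by split=> //; apply: e_diag.
have iq : i \notin R q.
  by apply: contraNN pq => iq; apply/eqP; apply: (relation_unique ij0).
have ir : i \notin R r.
  by apply: contraNN pr => ir; apply/eqP; apply: (relation_unique ij1).
have simp l : l \in R q -> l != j0 -> simple_pair l i.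
  move=> lq lj0 s ls is'; apply/negP => ms.
  have lp : l \notin R p.
    by apply: contraNN pq => lp; apply/eqP; apply: (relation_unique lj0).
  have ps : p != s by apply: contraNneq lp => ->.
  have qs : q != s by apply: contraNneq iq => ->.
  (* [s] is a common neighbour of [p] (via i) and [q] (via l), so it equals [r]. *)
  case/negP: ir; rewrite (unique_common_neighbour mp mq mr ms pq pr qr ps qs
    j0p j0q j1p j1r kq kr ip is' lq ls) //.
have kj0 : k != j0 by apply: contraNneq kp => ->.
have sik := simple_pairC (simp k kq kj0).
split=> //; have := e_jacobi j0 i k.
by rewrite (e_simple_pair _ sik) (e_one_exception simp kq j0q) !addr0.
Qed.

(** Either at most one index of [R p] is [bad], i.e. joined to [k] by a multiple
    relation, or [e_two_exceptions] shows that there are exactly two. *)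
Lemma e_nonlocal p i j k : i \in R p -> j \in R p -> k \notin R p -> e i j k = 0.
Proof.
move=> ip jp kp.
have [mp|mp] := boolP (mult p); last first.
  have [->|ij] := eqVneq i j; first exact: e_diag.
  by apply: e_simple_pair => q iq jq; rewrite -(relation_unique ij ip jp iq jq).
pose bad l := [exists q, [&& l \in R q, k \in R q & mult q]].
have badN l : ~~ bad l -> simple_pair l k.
  by move=> /existsPn lN q lq kq; have := lN q; rewrite lq kq.
have [/existsP[j0 /andP[j0p /existsP[q /and3P[j0q kq mq]]]]|good] :=
    boolP [exists j0 in R p, bad j0]; last first.
  apply: (@e_one_exception p k k) => // l lp _; apply: badN.
  by apply: contraNN good => bl; apply/existsP; exists l; rewrite lp.
have [/existsP[j1 /and3P[j1p j10 /existsP[r /and3P[j1r kr mr]]]]|good] :=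
    boolP [exists j1 in R p, (j1 != j0) && bad j1]; last first.
  apply: (@e_one_exception p k j0) => // l lp lj0; apply: badN.
  by apply: contraNN good => bl; apply/existsP; exists l; rewrite lp lj0.
have j01 : j0 != j1 by rewrite eq_sym.
have two0 := e_two_exceptions mp mq mr kp j01 j0p j1p j0q kq j1r kr.
have two1 := e_two_exceptions mp mr mq kp j10 j1p j0p j1r kr j0q kq.
have e01 : e j0 j1 k = 0.
  have := e_sum k j0p; rewrite (bigD1 j1) //= big1 ?addr0 // => l /andP[lp lj1].
  by have [] := two0 l lp lj1.
have e0 l : l \in R p -> e j0 l k = 0.
  by move=> lp; have [->//|lj1] := eqVneq l j1; have [] := two0 l lp lj1.
have e1 l : l \in R p -> e j1 l k = 0.
  move=> lp; have [->|lj0] := eqVneq l j0; last by have [] := two1 l lp lj0.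
  by rewrite e_antisym e01 oppr0.
have [->|ij0] := eqVneq i j0; first exact: e0.
have [->|ij1] := eqVneq i j1; first exact: e1.
have [->|jj0] := eqVneq j j0; first by rewrite e_antisym e0 ?oppr0.
have [->|jj1] := eqVneq j j1; first by rewrite e_antisym e1 ?oppr0.
have [si _] := two0 i ip ij1; have [sj _] := two0 j jp jj1.
by apply: e_two_simple_pairs; [apply: si | apply: sj].
Qed.

Lemma e_vanishes i j k : e i j k = 0.
Proof.
have [->|ij] := eqVneq i j; first exact: e_diag.
have [p [ip jp]] := relation_exists ij.
case: (boolP (k \in R p)) => kp; first exact: e_local kp.
exact: e_nonlocal kp.
Qed.

End Vanishing.

(** * Presentations *)

Section Words.
Local Open Scope group_scope.
Variable G : groupType.

Lemma prod_rot_eq1 (I : Type) k (s : seq I) (F : I -> G) :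
  \prod_(i <- s) F i = 1 -> \prod_(i <- rot k s) F i = 1.
Proof.
rewrite -{1}(cat_take_drop k s) /rot !big_cat /=.
by move/(canRL (mulKg _)) => ->; rewrite mulg1 mulVg.
Qed.

Lemma prod_single (I : eqType) (a : I) (s : seq I) (F : I -> G) :
    (forall i, i \in s -> i != a -> F i = 1) ->
  \prod_(i <- s) F i = F a ^+ count_mem a s.
Proof.
elim: s => [|i s IHs] F1; first by rewrite big_nil.
rewrite big_cons IHs => [|j js]; last by apply: F1; rewrite inE js orbT.
rewrite /= expgnDr; have [->//|ia] := eqVneq i a.
by rewrite F1 ?inE ?eqxx.
Qed.

(** Let [c] be the product of the word. If [u * v = v * u] for each splitting
    [c = u * v], then each prefix [u] commutes with [c], and so does each letter, as a
    quotient of two consecutive prefixes. *)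
Lemma commute_cyclic_word (I : eqType) (s : seq I) (F : I -> G) :
    (forall k, (k < size s)%N -> \prod_(i <- rot k s) F i = \prod_(i <- s) F i) ->
  forall i, i \in s -> commute (F i) (\prod_(i <- s) F i).
Proof.
move=> srot i si; set c := \prod_(i <- s) F i.
have comm_take k : (k <= size s)%N -> commute c (\prod_(i <- take k s) F i).
  rewrite leq_eqVlt => /predU1P[->|ks]; first by rewrite take_size.
  have := srot k ks; rewrite -/c /rot big_cat /= => dt.
  have cE : c = \prod_(i <- take k s) F i * \prod_(i <- drop k s) F i.
    by rewrite /c -{1}(cat_take_drop k s) big_cat.
  by rewrite /commute {1}cE -mulgA dt.
have ks : (index i s < size s)%N by rewrite index_mem.
have := comm_take _ ks; rewrite (take_nth i ks) nth_index // -cats1 big_cat big_seq1 /=.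
set u := \prod_(_ <- _) _ => cui.
have cu : commute c u by apply: comm_take; apply: ltnW.
apply: commute_sym; rewrite -(mulKg u (F i)); apply: commuteM => //.
exact: commuteV.
Qed.

Lemma presentation_lift (H : groupType) n (x : 'I_n -> G) (rels : set (free_group n))
    (y : 'I_n -> H) : is_presentation x rels ->
    (forall r, rels r -> free_lift y r = 1) ->
  exists f : UMagmaMorphism.type G H, forall i, f (x i) = y i.
Proof.
case=> xsurj xker yrels.
have yker s t : free_lift x s = free_lift x t -> free_lift y s = free_lift y t.
  move=> st; have /xker : free_lift x (s^-1 * t) = 1.
    by rewrite gmulfM gmulfV /= st mulVg.
  suff yN r : normal_closure rels r -> free_lift y r = 1.
    move/yN; rewrite gmulfM gmulfV => /(canRL (mulVKg _)).
    by rewrite mulg1.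
  elim=> [g [r' [r'rel [z ->]]]||g h _ g1 _ h1|g _ g1].
  - by rewrite gmulfJ /= yrels ?conj1g.
  - exact: gmulf1.
  - by rewrite gmulfM /= g1 h1 mulg1.
  - by rewrite gmulfV /= g1 invg1.
pose lift g := projT1 (cid (xsurj g)).
have liftK g : free_lift x (lift g) = g by exact: projT2 (cid (xsurj g)).
pose f g := free_lift y (lift g).
have f1 : f 1 = 1.
  by rewrite -[RHS](free_lift1 y); apply: yker; rewrite liftK free_lift1.
have fM : {morph f : g h / g * h}.
  by move=> g h; rewrite /f -free_liftM; apply: yker; rewrite free_liftM !liftK.
pose fmor : UMagmaMorphism.type G H :=
  HB.pack f (isUMagmaMorphism.Build G H f (f1, fM)).
exists fmor => i; rewrite -[RHS](free_lift_gen y).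
by apply: yker; rewrite liftK free_lift_gen.
Qed.

End Words.

(** * Local free quotients *)

Section Retract.
Local Open Scope group_scope.
Variables (n m : nat) (h : 'I_n) (t : m.-tuple 'I_n).
Hypothesis ht_uniq : uniq (h :: t).

(** The letters of the tail go to free generators; the value on the head makes the
    product of the whole word trivial; the other generators are killed. *)
Definition retract (i : 'I_n) : free_group m :=
  if [pick j | tnth t j == i] is Some j then free_gen j
  else if i == h then (\prod_(j < m) free_gen j)^-1 else 1.

Lemma retract_tnth j : retract (tnth t j) = free_gen j.
Proof.
rewrite /retract; case: pickP => [j' /eqP|/(_ j)]; last by rewrite eqxx.
by have /andP[_ /tuple_uniqP tinj] := ht_uniq; move/tinj ->.
Qed.

Lemma retract_head : retract h = (\prod_(j < m) free_gen j)^-1.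
Proof.
rewrite /retract; case: pickP => [j /eqP jh|_]; last by rewrite eqxx.
by have := ht_uniq; rewrite /= -jh mem_tnth.
Qed.

Lemma retract_out i : i \notin h :: t -> retract i = 1.
Proof.
rewrite inE negb_or /retract => /andP[/negPf ih it].
by case: pickP => [j /eqP ji|_]; [rewrite -ji mem_tnth in it | rewrite ih].
Qed.

Lemma prod_retract : \prod_(i <- h :: t) retract i = 1.
Proof.
rewrite big_cons big_tuple retract_head.
by under [X in _ * X]eq_bigr do rewrite retract_tnth; rewrite mulVg.
Qed.

End Retract.

Lemma cyclic_word_split n (A : {set 'I_n}) : (2 <= #|A|)%N ->
  exists ht : 'I_n * (#|A|.-1).-tuple 'I_n, cyclic_word A = ht.1 :: ht.2.
Proof.
move=> A2; have : size (cyclic_word A) = #|A| by rewrite size_rev -cardE.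
case: (cyclic_word A) => [|h t] /= szt; first by rewrite -szt in A2.
have st : size t == #|A|.-1 by rewrite -szt.
by exists (h, Tuple st).
Qed.

(** * Conjugation-free groups *)

Section ConjugationFree.
Local Open Scope group_scope.
Variables (G : groupType) (n w : nat) (x : 'I_n -> G) (R : 'I_w -> {set 'I_n}).
Hypothesis hG : conjugation_free_presentation x R.

Let pres := cf_presentation hG.
Let m p := #|R p|.-1.

Lemma mem_cyclic_word (A : {set 'I_n}) i : (i \in cyclic_word A) = (i \in A).
Proof. by rewrite mem_rev mem_enum. Qed.

Lemma cyclic_word_uniq (A : {set 'I_n}) : uniq (cyclic_word A).
Proof. by rewrite rev_uniq enum_uniq. Qed.

Lemma conjugation_free_generated g : generated (range x) g.
Proof. by have [s <-] := pres.1 g; apply: free_lift_generated. Qed.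

(** The element c_p, central in the subgroup generated by the x_i, i in R_p. *)
Definition cyclic_prod p : G := \prod_(i <- cyclic_word (R p)) x i.

Lemma cyclic_prod_rot p k : (k < #|R p|)%N ->
  \prod_(i <- rot k (cyclic_word (R p))) x i = cyclic_prod p.
Proof.
move=> kp; set r := (\prod_(i <- rot k (cyclic_word (R p))) free_gen i)^-1
  * \prod_(i <- cyclic_word (R p)) free_gen i.
have /pres.2 : normal_closure (fun r => exists p, cyclic_relators (R p) r) r.
  apply: generated_in; exists r; split; last by exists 1; rewrite conjg1.
  by exists p, k.
rewrite /r gmulfM gmulfV !gmulf_prod /= => /(canRL (mulVKg _)).
under eq_bigr do rewrite free_lift_gen.
by under [X in _ = X * _]eq_bigr do rewrite free_lift_gen; rewrite mulg1.
Qed.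

Lemma commute_cyclic_prod p i : i \in R p -> commute (x i) (cyclic_prod p).
Proof.
move=> ip; apply: commute_cyclic_word; last by rewrite mem_cyclic_word.
by move=> k; rewrite size_rev -cardE; apply: cyclic_prod_rot.
Qed.

Let split p := projT1 (cid (cyclic_word_split (cf_length hG p))).
Definition head_gen p : 'I_n := (split p).1.
Definition tail_gens p : (m p).-tuple 'I_n := (split p).2.

Lemma cyclic_wordE p : cyclic_word (R p) = head_gen p :: tail_gens p.
Proof. exact: projT2 (cid (cyclic_word_split (cf_length hG p))). Qed.

Lemma gens_uniq p : uniq (head_gen p :: tail_gens p).
Proof. by rewrite -cyclic_wordE cyclic_word_uniq. Qed.

Lemma mem_gens p i : (i \in head_gen p :: tail_gens p) = (i \in R p).
Proof. by rewrite -cyclic_wordE mem_cyclic_word. Qed.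

Let y p := retract (head_gen p) (tail_gens p).

(** Only a common index of [R p] and [R q] can survive, and there is at most one. *)
Lemma retract_single p q : p != q ->
  exists a, forall i, i \in R q -> i != a -> y p i = 1.
Proof.
move=> pq; have out i : i \notin R p -> y p i = 1.
  by move=> ip; apply: retract_out; rewrite mem_gens.
have /card_le1P le1 := cf_meet hG pq.
have [/existsP[a apq]|none] := boolP [exists a, a \in R p :&: R q].
  exists a => i iq ia; apply: out; apply: contraNN ia => ip.
  have := le1 a apq i; rewrite !inE ip iq => /esym; by [].
have /card_gt0P[a _] : (0 < #|R q|)%N by apply: leq_trans (cf_length hG q).
exists a => i iq _; apply: out; apply: contraNN none => ip.
by apply/existsP; exists i; rewrite inE ip.
Qed.

(** For the relation [p] itself all rotations have product 1. Any other relation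
    contains at most one letter with nontrivial image, so rotating its word changes
    nothing. *)
Lemma retract_relator p r : (exists q, cyclic_relators (R q) r) ->
  free_lift (y p) r = 1.
Proof.
case=> q [k _ ->]; rewrite gmulfM gmulfV !gmulf_prod /=.
under eq_bigr do rewrite free_lift_gen.
under [X in _ * X]eq_bigr do rewrite free_lift_gen.
have [<-|pq] := eqVneq p q.
  by rewrite prod_rot_eq1 cyclic_wordE prod_retract ?mulVg ?gens_uniq.
have [a ya] := retract_single pq.
rewrite !(@prod_single _ _ a).
- by rewrite (permP (permEl (perm_rot k _))) mulVg.
- by move=> i; rewrite mem_cyclic_word; apply: ya.
- by move=> i; rewrite mem_rot mem_cyclic_word; apply: ya.
Qed.

Definition local_quotient p : UMagmaMorphism.type G (free_group (m p)) :=
  projT1 (cid (presentation_lift pres (@retract_relator p))).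

Lemma local_quotient_gen p i : local_quotient p (x i) = y p i.
Proof. exact: (projT2 (cid (presentation_lift pres (@retract_relator p)))). Qed.

Definition local_section p : UMagmaMorphism.type (free_group (m p)) G :=
  free_lift (fun j => x (tnth (tail_gens p) j)).

Lemma local_section_gen p j : local_section p (free_gen j) = x (tnth (tail_gens p) j).
Proof. exact: free_lift_gen. Qed.

Lemma local_sectionK p v :
  gr_map (local_quotient p) (gr_map (k := 3) (local_section p) v) = v.
Proof.
move: v; apply: (gr3_ind (@free_group_generated (m p))).
- by rewrite !raddf0.
- by move=> u v ue ve; rewrite !raddfD /= ue ve.
- by move=> u ue; rewrite !raddfN /= ue.
move=> _ _ _ [i _ <-] [j _ <-] [k _ <-].
rewrite !gr_map_triple !local_section_gen !local_quotient_gen.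
by rewrite /y !retract_tnth ?gens_uniq.
Qed.

Lemma local_quotient_local q i j k p : p != q -> i \in R q -> j \in R q ->
  gr_map (local_quotient p) (triple (x i) (x j) (x k)) = 0%R.
Proof.
move=> pq iq jq; rewrite gr_map_triple !local_quotient_gen.
exact: (triple_single (A := R q) (retract_single pq)).
Qed.

Lemma local_section_orthogonal p q v : p != q ->
  gr_map (local_quotient q) (gr_map (k := 3) (local_section p) v) = 0%R.
Proof.
move=> pq; move: v; apply: (gr3_ind (@free_group_generated (m p))).
- by rewrite !raddf0.
- by move=> u v ue ve; rewrite !raddfD /= ue ve addr0.
- by move=> u ue; rewrite !raddfN /= ue oppr0.
move=> _ _ _ [i _ <-] [j _ <-] [k _ <-].
rewrite gr_map_triple !local_section_gen.
apply: (local_quotient_local (q := p)); rewrite 1?eq_sym //.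
all: by rewrite -mem_gens inE mem_tnth orbT.
Qed.

(** On x_i with i in R_p, the composite s_p f_p is the identity up to the central
    element c_p: for the head x_h = c_p * (product of the tail)^-1. *)
Lemma local_retraction_gen p i : i \in R p ->
  exists z, (z = 1 \/ z = (cyclic_prod p)^-1) /\
    local_section p (local_quotient p (x i)) = x i * z.
Proof.
rewrite -mem_gens inE local_quotient_gen => /predU1P[->|/tnthP[j ->]]; last first.
  exists 1; split; first by left.
  by rewrite /y retract_tnth ?gens_uniq // local_section_gen mulg1.
exists (cyclic_prod p)^-1; split; first by right.
rewrite /y retract_head ?gens_uniq // gmulfV gmulf_prod /=.
under eq_bigr do rewrite local_section_gen.
have hp : head_gen p \in R p by rewrite -mem_gens inE eqxx.
rewrite (commuteV (commute_cyclic_prod hp)).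
by rewrite /cyclic_prod cyclic_wordE big_cons big_tuple invgM mulgVK.
Qed.

Lemma local_retraction_triple p i j k : i \in R p -> j \in R p -> k \in R p ->
  gr_map (local_section p) (gr_map (local_quotient p) (triple (x i) (x j) (x k)))
    = triple (x i) (x j) (x k).
Proof.
move=> ip jp kp; rewrite !gr_map_triple.
have [z [zE ->]] := local_retraction_gen ip.
have [z' [z'E ->]] := local_retraction_gen jp.
have [z'' [z''E ->]] := local_retraction_gen kp.
have cxz l u : l \in R p -> u = 1 \/ u = (cyclic_prod p)^-1 -> commute (x l) u.
  by move=> lp [->|->]; [apply: commute1 | apply/commuteV/commute_cyclic_prod].
have czz u v : u = 1 \/ u = (cyclic_prod p)^-1 -> v = 1 \/ v = (cyclic_prod p)^-1 ->
    commute u v.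
  by move=> [->|->] [->|->]; do ?[exact: commute1 | apply: commute_sym].
by apply: triple_mul_commuting; first [exact: cxz | exact: czz | exact/commute_sym/cxz].
Qed.

Hypothesis hbeta : (betti1 (Gr R) <= 1)%N.

(** The projection of gr_3 onto the complement of the local contributions. *)
Definition nonlocal (v : gr 3 G) : gr 3 G :=
  (v - \sum_p gr_map (local_section p) (gr_map (local_quotient p) v))%R.

Lemma nonlocalD : {morph nonlocal : u v / (u + v)%R}.
Proof.
move=> u v; rewrite /nonlocal addrACA -opprD -big_split /=.
by congr (_ - _)%R; apply: eq_bigr => p _; rewrite !raddfD.
Qed.

Lemma nonlocal0 : nonlocal 0%R = 0%R.
Proof. by apply: (addrI (nonlocal 0%R)); rewrite -nonlocalD !addr0. Qed.

Lemma nonlocalN u : nonlocal (- u)%R = (- nonlocal u)%R.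
Proof. by apply: (addrI (nonlocal u)); rewrite -nonlocalD !subrr nonlocal0. Qed.

Lemma nonlocal_local p i j k : i \in R p -> j \in R p -> k \in R p ->
  nonlocal (triple (x i) (x j) (x k)) = 0%R.
Proof.
move=> ip jp kp; rewrite /nonlocal (bigD1 p) //= big1 => [|q qp].
  by rewrite addr0 local_retraction_triple ?subrr.
by rewrite (local_quotient_local k qp ip jp) raddf0.
Qed.

(** Reduces to [e_vanishes]; its sum relation holds since
    T(x_i, c_p, x_k) = 0 expands, by additivity, to a sum over R_p. *)
Lemma nonlocal_eq0 v : nonlocal v = 0%R.
Proof.
move: v; apply: (gr3_ind conjugation_free_generated); first exact: nonlocal0.
- by move=> u v u0 v0; rewrite nonlocalD u0 v0 addr0.
- by move=> u u0; rewrite nonlocalN u0 oppr0.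
move=> _ _ _ [i _ <-] [j _ <-] [k _ <-]; move: i j k.
apply: (@e_vanishes _ _ R (cf_pair hG) hbeta _
  (fun i j k => nonlocal (triple (x i) (x j) (x k)))).
- by move=> i k; rewrite triple11 nonlocal0.
- by move=> i j k; rewrite triple_antisym nonlocalN.
- by move=> i j k; rewrite -!nonlocalD triple_jacobi nonlocal0.
- exact: nonlocal_local.
move=> p i k ip; rewrite -(big_morph _ nonlocalD nonlocal0).
apply: etrans nonlocal0; congr nonlocal.
have := triple_commute (x k) (commute_cyclic_prod ip).
by rewrite /cyclic_prod triple_prod2 (perm_big _ (permEl (perm_rev _))) big_enum.
Qed.

(** The f_p and s_p identify gr_3(G) with the direct sum of the gr_3(F_(t_p - 1)). *)
Lemma phi3_sum : phi 3 G = (\sum_p omega 3 (m p))%N.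
Proof.
pose N p := gr3_rational_basis_exists (@free_group_generated (m p)).
pose r p := projT1 (cid (N p)).
pose a p := projT1 (cid (projT2 (cid (N p)))).
have ab p : rational_basis (a p) := projT2 (cid (projT2 (cid (N p)))).
have := @rational_basis_direct_sum _ (gr 3 G) (fun p => gr 3 (free_group (m p)))
  (fun p => gr_map (k := 3) (local_quotient p))
  (fun p => gr_map (k := 3) (local_section p))
  (fun p => 'I_(r p)) a local_sectionK.
move=> /(_ (fun p q v => @local_section_orthogonal p q v)).
have decomp (v : gr 3 G) :
    v = (\sum_p gr_map (local_section p) (gr_map (local_quotient p) v))%R.
  by apply/eqP; rewrite -subr_eq0; apply/eqP; exact: (nonlocal_eq0 v).
move=> /(_ decomp ab)/phi_rational_basis ->.
rewrite card_tagged sumnE big_map big_enum /=; apply: eq_bigr => p _.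
by rewrite card_ord; symmetry; rewrite /omega (phi_rational_basis (ab p)) card_ord.
Qed.

End ConjugationFree.

Theorem theorem3p5 (G : groupType) (n w : nat) (x : 'I_n -> G)
    (R : 'I_w -> {set 'I_n})
    (hG : conjugation_free_presentation x R)
    (hbeta : (betti1 (Gr R) <= 1)%N) :
  phi 3 G = (\sum_(3 <= i < n.+1) num_relations R i * omega 3 i.-1)%N.
Proof.
rewrite (phi3_sum hG hbeta).
(* Write each [num_relations R i] as a sum over the relations and exchange the sums. *)
under [RHS]eq_bigr => i _.
  rewrite /num_relations -sum1_card big_distrl /=.
  under eq_bigl do rewrite inE.
  rewrite big_mkcond /=; over.
rewrite exchange_big /=; apply: eq_bigr => p _.
under eq_bigr do rewrite eq_sym mul1n.
have Rn : (#|R p| <= n)%N by rewrite -[n in (_ <= n)%N]card_ord max_card.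
rewrite -big_mkcond big_nat1_eq ltnS Rn andbT.
have := cf_length hG p; rewrite leq_eqVlt => /predU1P[<-|->//].
by rewrite omega3_1.
Qed.
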